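(* Let $k\ge4$ be a power of $2$. Then the maximum size of a regular intersecting family $\mathcal{F}\subset\binom{[2k]}{k}$ equals $\binom{2k-1}{k}-3$.
   Context: $[2k]=\{1,\dots,2k\}$, $\binom{[2k]}{k}$ is the set of $k$-subsets of $[2k]$. A family is intersecting if any two of its members intersect; it is regular if every element of $[2k]$ lies in the same number of members of the family. *)

(* Defs.v *)
From mathcomp Require Import all_boot.

Set Implicit Arguments.
Unset Strict Implicit.
Unset Printing Implicit Defensive.

Section Families.

Variable T : finType.
Implicit Types F : {set {set T}}.

Definition uniform_family (k : nat) F : bool :=
  [forall A in F, #|A| == k].

(* A and B are allowed to coincide; this only matters if set0 \in F. *)
Definition intersecting_family F : bool :=
  [forall A in F, forall B in F, A :&: B != set0].

Definition family_degree F (x : T) : nat := #|[set A in F | x \in A]|.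

Definition regular_family F : bool :=
  [forall x, forall y, family_degree F x == family_degree F y].

End Families.

(* Main.v *)
(* A [k]-set of [[2k]] is disjoint only from its complement, so an intersecting
   family selects at most one set from each complementary pair, whence
   [#|F| <= C := 'C(2k-1, k)]; for [k] a power of 2, [C] is odd, while regularity
   forces [#|F|] to be even.  If [F] misses a single pair [{A, ~: A}], take
   [x \in A] and [y \notin A]: the number of members of [F] separating [x] from
   [y] is ['C(2k-2, k-1) - 1], which is odd, so [x] and [y] have degrees of
   different parity.

   For the converse, omit the three pairs formed by the unions of two blocks in
   a partition of [[2k]] into four blocks of size [k/2].  Every selection from
   the remaining pairs now has all its degrees of the same parity, and replacing
   one set by its complement changes this parity, so it can be made that of
   [#|F|/2].  If [deg y + 2 < deg x], some [S] containing [x] but not [y] belongs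
   to [F] together with the set obtained from [~: S] by exchanging [y] for [x];
   complementing both lowers [deg x] by 2, raises [deg y] by 2 and changes no
   other degree.  Hence a selection minimizing the sum of squared degrees has
   all degrees within 2 of each other, and as they are congruent modulo 2 to
   their average [#|F|/2], they are all equal to it. *)

Require Import Defs.
From mathcomp Require Import all_boot zify.

Set Implicit Arguments.
Unset Strict Implicit.
Unset Printing Implicit Defensive.

(** * Parity of binomial coefficients *)

Lemma odd_bin_pow2_pred n j : j < 2 ^ n -> odd 'C((2 ^ n).-1, j).
Proof.
elim: j => [|j IHj] lt_jn; first by rewrite bin0.
(* As [2 ^ n] divides [j.+1 * 'C(2 ^ n, j.+1)], an odd binomial would force it to divide the smaller
   [j.+1]. Pascal's rule then carries oddness from [j] to [j.+1]. *)
have even_bin : ~~ odd 'C(2 ^ n, j.+1).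
  rewrite -dvdn2; apply: contraLR lt_jn => odd_bin; rewrite -leqNgt.
  apply: dvdn_leq => //; rewrite -(@Gauss_dvdl _ _ 'C(2 ^ n, j.+1)).
    by rewrite -mul_bin_diag dvdn_mulr.
  by rewrite coprimeXl // prime_coprime.
move: even_bin; rewrite -{1}(@prednK (2 ^ n)) ?expn_gt0 // binS oddD.
by rewrite IHj 1?ltnW // addbT negbK.
Qed.

Lemma bin_double n : 0 < n -> 'C(2 * n, n) = 2 * 'C(2 * n - 1, n).
Proof.
case: n => // n _; rewrite mulnS add2n subn1 /= binS.
have -> : 'C((2 * n).+1, n) = 'C((2 * n).+1, n.+1).
  by rewrite -[RHS]bin_sub; [congr 'C(_, _); lia | lia].
lia.
Qed.

(** * Degrees, separating sets and selections from complementary pairs *)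

Section Halves.

Variable T : finType.
Implicit Types (x y : T) (A S : {set T}) (F K L : {set {set T}}).

Definition layer k : {set {set T}} :=
  [set A : {set T} | #|A| == k].

Definition separating F x y := [set A in F | (x \in A) && (y \notin A)].

(* [F] contains exactly one set out of each pair [{A, ~: A}] contained in [K],
   and no other set. *)
Definition halves F K :=
  [forall A, (A \in F) + (~: A \in F) == (A \in K)].

(* Used only for [x \in S] and [y \notin S]: the complement of the image of [S]
   under the transposition of [x] and [y]. *)
Definition mirror x y S := x |: (~: S :\ y).

Lemma card_separating_layer k x y :
  x != y -> #|separating (layer k.+1) x y| = 'C(#|T| - 2, k).
Proof.
move=> neq_xy; have cardC : #|~: [set x; y]| = #|T| - 2.
  by rewrite cardsCs setCK cards2 neq_xy.
have subC A : (A \subset ~: [set x; y]) = (x \notin A) && (y \notin A).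
  by rewrite subsetC subUset !sub1set !inE.
(* Adding [x] is a bijection from the [k]-sets avoiding [x] and [y]. *)
rewrite -cardC -cards_draws -(card_in_imset (f := setU [set x])) => [|A B]; last first.
  rewrite !inE !subC => /andP[/andP[xA _] _] /andP[/andP[xB _] _].
  by move=> /(congr1 (fun A => A :\ x)); rewrite !setU1K.
apply: eq_card => A; rewrite !inE; apply/and3P/imsetP => [[cardA xA yA]|[B]].
  exists (A :\ x); last by rewrite setD1K.
  rewrite inE subC !inE eqxx (negPf yA) andbF /=.
  by move: cardA; rewrite (cardsD1 x) xA.
rewrite inE subC => /andP[/andP[xB yB] /eqP cardB] ->.
by rewrite !inE eqxx cardsU1 xB cardB negb_or (eq_sym y) neq_xy yB.
Qed.

Lemma card_separatingD K L x y : K \subset L ->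
  #|separating L x y| = #|separating K x y| + #|separating (L :\: K) x y|.
Proof.
move=> sKL; rewrite -(cardsID K (separating L x y)).
by congr (_ + _); apply: eq_card => A;
  rewrite !inE; case: (boolP (A \in K)) => //= [/(subsetP sKL)->|_];
  rewrite ?andbT ?andbF.
Qed.

(** Both sides count the members of [F] that meet [{x, y}]. *)
Lemma degree_separating F x y :
  family_degree F x + #|separating F y x|
  = family_degree F y + #|separating F x y|.
Proof.
rewrite /family_degree -(cardsID [set A : {set T} | y \in A] [set A in F | x \in A]).
rewrite -(cardsID [set A : {set T} | x \in A] [set A in F | y \in A]).
rewrite -addnA [RHS]addnAC -addnA; congr (_ + _).
  by apply: eq_card => A; rewrite !inE andbAC.
by congr (_ + _); apply: eq_card => A; rewrite !inE;
  case: (A \in F); case: (x \in A); case: (y \in A).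
Qed.

Lemma sum_degree k F : uniform_family k F -> \sum_x family_degree F x = k * #|F|.
Proof.
move=> /forall_inP unifF.
under eq_bigr => x _ do rewrite /family_degree -sum1dep_card.
rewrite (exchange_big_dep (mem F)) /=; last by move=> x A _ /andP[].
rewrite mulnC -sum_nat_const; apply: eq_bigr => A AF.
rewrite -(eqP (unifF A AF)) -sum1_card; apply: eq_bigl => x.
by rewrite AF.
Qed.

Lemma halves_card F K : halves F K -> #|K| = 2 * #|F|.
Proof.
move=> /forallP hF; rewrite -sum1_card big_mkcond /=.
under eq_bigr => A _ do rewrite -[if _ then _ else _]/(nat_of_bool _) -(eqP (hF A)).
rewrite big_split /= [X in _ + X](reindex_inj (can_inj (@setCK T))) /=.
under [X in _ + X]eq_bigr => A _ do rewrite setCK.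
by rewrite -[#|F|]sum1_card [in RHS]big_mkcond /= mul2n addnn.
Qed.

(** Complementation sends the members of [K] outside [F] that separate [x] from [y] to the members
    of [F] that separate [y] from [x]. *)
Lemma halves_separating F K x y : halves F K ->
  #|separating K x y| = #|separating F x y| + #|separating F y x|.
Proof.
move=> /forallP hF; rewrite -(cardsID F (separating K x y)); congr (_ + _).
  apply: eq_card => A; rewrite !inE.
  by move: (hF A); case: (A \in K); case: (A \in F); case: (~: A \in F); rewrite ?andbT ?andbF.
rewrite -(card_imset _ (can_inj (@setCK T))); apply: eq_card => A.
apply/imsetP/idP => [[B]|].
  rewrite !inE => /andP[BF /and3P[BK xB yB]] ->; rewrite !inE xB yB.
  by move: (hF B) BF; rewrite BK; case: (B \in F); case: (~: B \in F).
rewrite !inE => /and3P[AF yA xA]; exists (~: A); last by rewrite setCK.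
rewrite !inE xA yA /= andbT; move: (hF (~: A)); rewrite setCK AF.
by case: (~: A \in F); case: (~: A \in K).
Qed.

(** Whether two degrees agree modulo 2 thus depends on [K] only, not on the selection. *)
Lemma halves_odd_degree F K x y : halves F K ->
  odd (family_degree F x) (+) odd (family_degree F y) = odd #|separating K x y|.
Proof.
move=> hF; rewrite (halves_separating x y hF).
have := congr1 odd (degree_separating F x y); rewrite !oddD.
by do 4![case: (odd _)].
Qed.

Lemma halves_disjoint F K A : halves F K -> A \in F -> ~: A \notin F.
Proof. by move=> /forallP/(_ A) + AF; rewrite AF; case: (~: A \in F); case: (A \in K). Qed.

Lemma halves_sub F K : halves F K -> F \subset K.
Proof.
move=> /forallP hF; apply/subsetP => A AF; move: (hF A); rewrite AF.
by case: (A \in K) => //; case: (~: A \in F).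
Qed.

Lemma halves_setC F K A : halves F K -> (~: A \in K) = (A \in K).
Proof.
move=> /forallP hF; move: (hF A) (hF (~: A)); rewrite setCK addnC => /eqP ->.
by case: (A \in K); case: (~: A \in K).
Qed.

Lemma uniform_sub_layer k F : (F \subset layer k) = uniform_family k F.
Proof.
apply/subsetP/forall_inP => FP A /FP; by rewrite inE.
Qed.

Definition flip A F := ~: A |: F :\ A.

Lemma halves_flip F K A : halves F K -> A \in F -> halves (flip A F) K.
Proof.
move=> hF AF; have ACF := halves_disjoint hF AF.
have neqA : ~: A != A by apply: contraNneq ACF => ->.
move/forallP: hF => hF; apply/forallP=> B; rewrite -(eqP (hF B)) !inE.
have -> : (~: B == A) = (B == ~: A) by rewrite -(can_eq (@setCK T)) setCK.
rewrite (can_eq (@setCK T)).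
have [->|neqBA] := eqVneq B A; first by rewrite (eq_sym A) (negPf neqA) AF (negPf ACF).
have [->|//] := eqVneq B (~: A).
by rewrite setCK AF (negPf ACF).
Qed.

Lemma degree_flip F K A z : halves F K -> A \in F ->
  family_degree (flip A F) z + (z \in A) = family_degree F z + (z \notin A).
Proof.
move=> hF AF; have ACF := halves_disjoint hF AF; rewrite /family_degree.
case: (boolP (z \in A)) => zA /=; rewrite addn0 ?addn1.
  rewrite [RHS](cardsD1 A) inE AF zA add1n; congr _.+1; apply: eq_card => B.
  rewrite !inE andbA; case: (eqVneq B (~: A)) => //= ->.
  by rewrite inE zA !andbF.
rewrite -add1n (_ : 1 = (~: A \notin [set B in F | z \in B] : nat)).
  rewrite -cardsU1; apply: eq_card => B; rewrite !inE.
  case: (eqVneq B (~: A)) => [->|_] /=; first by rewrite inE zA.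
  by case: (eqVneq B A) => //= ->; rewrite (negPf zA) andbF.
by rewrite inE (negPf ACF).
Qed.

(** * The middle layer: [k]-sets in [2k] points *)

Section Middle.

Variable k : nat.
Hypothesis cardT : #|T| = 2 * k.

Lemma setC_layer A : (~: A \in layer k) = (A \in layer k).
Proof. rewrite !inE cardsCs setCK cardT.
have : #|A| <= #|T| by apply: max_card.
by rewrite cardT; lia.
Qed.

Lemma even_separating_layer x y :
  1 < k -> ~~ odd #|separating (layer k) x y|.
Proof.
move=> k_gt1; have [<-|neq_xy] := eqVneq x y.
  by rewrite (_ : separating _ _ _ = set0) ?cards0 //; apply/setP=> A; rewrite !inE andbN andbF.
case: k cardT k_gt1 => // k' cT k_gt1; rewrite card_separating_layer // cT.
rewrite (_ : _ - 2 = 2 * k'); last by lia.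
(* The count is a central binomial coefficient, hence even. *)
by rewrite bin_double // oddM.
Qed.

Lemma intersecting_halves F : 
  uniform_family k F -> intersecting_family F ->
  exists2 K, halves F K & K \subset layer k.
Proof.
move=> /forall_inP unifF /forall_inP intF.
(* The closure of [F] under complementation; [F] never contains both sets of a pair, as these are
   disjoint. *)
exists [set A | (A \in F) || (~: A \in F)].
  apply/forallP=> A; rewrite inE.
  case: (boolP (A \in F)) => [AF|_] /=; last by case: (~: A \in F).
  case: (boolP (~: A \in F)) => // ACF.
  by have /forall_inP/(_ _ ACF) := intF A AF; rewrite setICr eqxx.
by apply/subsetP => A; rewrite inE => /orP[] /unifF; last rewrite -setC_layer;
  rewrite inE.
Qed.

Lemma halves_intersecting F K : 
  halves F K -> K \subset layer k -> intersecting_family F.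
Proof.
move=> hF sKL; apply/forall_inP => A AF; apply/forall_inP => B BF.
have /subsetP sF := subset_trans (halves_sub hF) sKL.
apply: contraNneq (halves_disjoint hF AF) => AB0.
suff -> : ~: A = B by [].
apply/esym/eqP; rewrite eqEcard -disjoints_subset -setI_eq0 setIC AB0 eqxx.
have := sF _ AF; rewrite -setC_layer inE => /eqP ->.
by have := sF _ BF; rewrite inE => /eqP ->; rewrite leqnn.
Qed.

Lemma regular_degree F x :
  0 < k -> uniform_family k F -> regular_family F -> #|F| = 2 * family_degree F x.
Proof.
move=> k_gt0 /sum_degree sumF /forallP regF; move: sumF.
rewrite (eq_bigr (fun _ => family_degree F x)) => [|y _]; last first.
  by apply/eqP; have /forallP := regF y.
by rewrite sum_nat_const cardT -mulnA mulnCA => /eqP; rewrite eqn_pmul2l // => /eqP.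
Qed.

(** * The upper bound *)

Lemma regular_intersecting_le F :
  1 < k -> odd 'C(2 * k - 1, k) ->
  uniform_family k F -> intersecting_family F -> regular_family F ->
  #|F| <= 'C(2 * k - 1, k) - 3.
Proof.
move=> k_gt1 oddC unifF intF regF.
have k_gt0 : 0 < k by lia.
have [K hF sKL] := intersecting_halves unifF intF.
have cardK := halves_card hF.
have cardL : #|layer k| = 2 * 'C(2 * k - 1, k).
  by rewrite card_draws cardT bin_double.
have leKL := subset_leq_card sKL.
have /card_gt0P[x0 _] : 0 < #|T| by rewrite cardT; lia.
have cardF := regular_degree x0 k_gt0 unifF regF.
have cardD := cardsD (layer k) K; rewrite (setIidPr sKL) in cardD.
(* The number of missing pairs is ['C(2 * k - 1, k) - #|F|], odd minus even; if it is not 1, it is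
   at least 3. *)
suff : #|layer k :\: K| != 2 by lia.
apply/negP => /eqP card2.
have /card_gt0P[A] : 0 < #|layer k :\: K| by rewrite card2.
have symD B : (~: B \in layer k :\: K) = (B \in layer k :\: K).
  by rewrite in_setD setC_layer [RHS]in_setD (halves_setC _ hF).
move=> AD; have := AD; rewrite !inE => /andP[_ /eqP cardA].
have [x xA] : exists x, x \in A by apply/card_gt0P; rewrite cardA.
have [y yA] : exists y, y \in ~: A.
  by apply/card_gt0P; rewrite cardsCs setCK cardA cardT; lia.
have defD : layer k :\: K = [set A; ~: A].
  apply/esym/eqP; rewrite eqEcard card2 subUset !sub1set symD AD /= cards2.
  by case: eqP => // /setP/(_ x); rewrite inE xA.
(* This even number is the count in [K], even by regularity, plus the count in [{A, ~: A}], which is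
   1. *)
have := even_separating_layer x y k_gt1.
rewrite (card_separatingD x y sKL) defD oddD -(halves_odd_degree x y hF).
have /forallP/(_ y)/eqP -> := forallP regF x; rewrite addbb.
suff -> : separating [set A; ~: A] x y = [set A] by rewrite cards1.
apply/setP=> B; rewrite !inE in yA *.
by case: eqP => [->|_] /=; rewrite ?xA ?yA //; case: eqP => // ->; rewrite !inE xA.
Qed.

(** * Balancing the degrees *)

Lemma card_mirror S x y : x \in S -> y \notin S -> #|S| = k ->
  #|mirror x y S| = k.
Proof.
move=> xS yS cardS; rewrite cardsU1 !inE xS andbF.
have := cardsD1 y (~: S); rewrite inE yS [#|~: S|]cardsCs setCK cardT cardS; lia.
Qed.

Lemma mirror_neq S x y : x \in S -> #|S| = k -> 1 < k -> mirror x y S != S.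
Proof.
move=> xS cardS k_gt1; have := cardsD1 x S; rewrite xS cardS => card_Sx.
have /card_gt0P[z] : 0 < #|S :\ x| by lia.
rewrite !inE => /andP[zx zS]; apply/eqP => /setP/(_ z).
by rewrite !inE (negPf zx) zS andbF.
Qed.

(** Otherwise [X = separating F x y] and its mirror image are disjoint and of equal size inside
    [separating (layer k) x y], so [2 * #|X| <= #|X| + #|separating F y x| + 2], which bounds the
    degree gap by 2. *)
Lemma exists_mirror F K x y : halves F K -> K \subset layer k ->
    #|separating (layer k :\: K) x y| <= 2 ->
    family_degree F y + 2 < family_degree F x ->
  exists2 S, (S \in separating F x y) & mirror x y S \in F.
Proof.
move=> hF sKL sep2 lt_deg.
suff /exists_inP[S sS mS] : [exists S in separating F x y, mirror x y S \in F] by exists S.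
apply: contraLR lt_deg; rewrite negb_exists_in -leqNgt => /forall_inP noS.
pose X := separating F x y.
have subFL : F \subset layer k := subset_trans (halves_sub hF) sKL.
have mirror_inj : {in X &, injective (mirror x y)}.
  move=> S1 S2; rewrite !inE => /and3P[_ x1 y1] /and3P[_ x2 y2] /setP eqm.
  apply/setP=> z; have := eqm z; rewrite !inE.
  have [->|_] := eqVneq z x; first by rewrite x1 x2.
  have [->|_] := eqVneq z y; first by rewrite (negPf y1) (negPf y2).
  by move=> /(can_inj negbK).
have disjX : X :&: mirror x y @: X = set0.
  apply/setP=> A; rewrite inE [RHS]inE; apply/negP => /andP[AX /imsetP[S SX eA]].
  by have := noS S SX; rewrite -eA; move: AX; rewrite inE => /andP[->].
have subX : X :|: mirror x y @: X \subset separating (layer k) x y.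
  apply/subsetP=> A; rewrite inE => /orP[|/imsetP[S + ->]]; rewrite !inE.
    by move=> /and3P[/(subsetP subFL)]; rewrite inE => -> -> ->.
  move=> /and3P[/(subsetP subFL)]; rewrite inE => /eqP cardS xS yS.
  by rewrite card_mirror // !eqxx /= orbF; apply: contraNneq yS => ->.
have := subset_leq_card subX; rewrite cardsU disjX cards0 subn0 card_in_imset //.
rewrite (card_separatingD x y sKL) (halves_separating x y hF) -/X.
have := degree_separating F x y; rewrite -/X; move: sep2.
by move: #|X| #|separating F y x| #|separating (_ :\: _) x y|; lia.
Qed.

(** A point other than [x] and [y] lies in exactly one of [S] and its mirror, so the two flips
    cancel there. *)
Lemma mirror_flip F K x y : 1 < k -> halves F K -> K \subset layer k ->
    #|separating (layer k :\: K) x y| <= 2 ->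
    family_degree F y + 2 < family_degree F x ->
  exists2 F', halves F' K &
    [/\ family_degree F' x + 2 = family_degree F x,
        family_degree F' y = family_degree F y + 2
      & forall z, z != x -> z != y -> family_degree F' z = family_degree F z].
Proof.
move=> k_gt1 hF sKL sep2 lt_deg.
have [S + mSF] := exists_mirror hF sKL sep2 lt_deg.
rewrite inE => /and3P[SF xS yS].
have cardS : #|S| = k.
  by apply/eqP; have /(subsetP sKL) := subsetP (halves_sub hF) _ SF; rewrite inE.
have hF1 := halves_flip hF SF.
have mSF1 : mirror x y S \in flip S F.
  by rewrite !inE mSF mirror_neq ?orbT.
exists (flip (mirror x y S) (flip S F)); first exact: halves_flip.
have neq_xy : x != y by apply: contraNneq yS => <-.
split=> [||z zx zy]; have := degree_flip _ hF1 mSF1; have := degree_flip _ hF SF.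
- by move=> /(_ x) + /(_ x); rewrite !inE xS eqxx; lia.
- by move=> /(_ y) + /(_ y); rewrite !inE (negPf yS) eqxx eq_sym (negPf neq_xy); lia.
by move=> /(_ z) + /(_ z); rewrite !inE (negPf zx) zy /=; case: (z \in S) => /=; lia.
Qed.

Lemma exists_regular_halves F0 K : 1 < k -> halves F0 K -> K \subset layer k ->
    ~~ odd #|F0| ->
    (forall x y, #|separating (layer k :\: K) x y| <= 2) ->
    (forall x y, ~~ odd #|separating K x y|) ->
  exists2 F, halves F K & regular_family F.
Proof.
move=> k_gt1 hF0 sKL evenF0 sep2 evenK.
have /card_gt0P[o _] : 0 < #|T| by rewrite cardT; lia.
pose h := #|F0|./2.
have cardF F : halves F K -> #|F| = 2 * h.
  by move=> hF; have := halves_card hF0; rewrite (halves_card hF) /h; lia.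
have odd_degree F x y : halves F K ->
    odd (family_degree F x) = odd (family_degree F y).
  move=> hF; have := halves_odd_degree x y hF; rewrite (negPf (evenK x y)).
  by do 2![case: (odd _)].
pose good F := halves F K && (odd (family_degree F o) == odd h).
have [F1 good1] : exists F, good F.
  have [odd0|neq0] := eqVneq (odd (family_degree F0 o)) (odd h).
    by exists F0; rewrite /good hF0 odd0 eqxx.
  (* An empty [F0] would have degree and [h] both 0, hence of equal parity. *)
  have /card_gt0P[A AF] : 0 < #|F0|.
    have : family_degree F0 o <= #|F0|.
      by apply: subset_leq_card; apply/subsetP=> A; rewrite inE => /andP[].
    by move: neq0; rewrite /h; lia.
  exists (flip A F0); rewrite /good halves_flip //=.
  have := degree_flip o hF0 AF; move: neq0; case: (o \in A) => /=; lia.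
have := arg_minnP (fun F => \sum_z family_degree F z ^ 2) good1.
case=> F /andP[hF /eqP oddF] minF; exists F => //.
have le_degree x y : family_degree F x <= family_degree F y + 2.
  rewrite leqNgt; apply/negP => lt_deg.
  have [F' hF' [degx degy degz]] := mirror_flip k_gt1 hF sKL (sep2 x y) lt_deg.
  have good' : good F'.
    rewrite /good hF' -oddF (odd_degree F' o x) // (odd_degree F o x) // -degx.
    by rewrite oddD addbF eqxx.
  have neq_yx : y != x by apply: contraTneq lt_deg => ->; lia.
  (* With degrees [a] and [b] at [x] and [y], the sum of squares changes by [8 - 4 * (a - b)],
     negative as [b + 2 < a]. *)
  have := minF F' good'; rewrite (bigD1 x) // (bigD1 y) //=.
  rewrite [X in _ <= X -> _](bigD1 x) //= [X in _ <= _ + X -> _](bigD1 y) //=.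
  under [X in _ <= _ + (_ + X)]eq_bigr => z /andP[zx zy] do rewrite degz //.
  by rewrite degy -degx; move: lt_deg; rewrite -degx; nia.
have sumF : \sum_z family_degree F z = #|T| * h.
  rewrite (@sum_degree k) -?uniform_sub_layer ?(cardF _ hF) ?cardT; first by lia.
  exact: subset_trans (halves_sub hF) sKL.
have odd_degreeF z : odd (family_degree F z) = odd h by rewrite (odd_degree F z o).
suff degF z : family_degree F z = h.
  by apply/forallP=> x; apply/forallP=> y; rewrite !degF.
(* A degree below [h] is at most [h - 2] by parity, so no degree exceeds [h] and the sum is too
   small. The other case is symmetric. *)
case: (ltngtP (family_degree F z) h) => // lt_h.
  suff : \sum_z family_degree F z < #|T| * h by rewrite sumF ltnn.
  rewrite -sum_nat_const (bigD1 z) //= [X in _ < X](bigD1 z) //= -addSn.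
  apply: leq_add => //; apply: leq_sum => w _.
  by have := le_degree w z; have := odd_degreeF z; have := odd_degreeF w; lia.
suff : #|T| * h < \sum_z family_degree F z by rewrite sumF ltnn.
rewrite -sum_nat_const (bigD1 z) //= [X in _ < X](bigD1 z) //= -addSn.
apply: leq_add => //; apply: leq_sum => w _.
by have := le_degree z w; have := odd_degreeF z; have := odd_degreeF w; lia.
Qed.

End Middle.

(** * The construction from four blocks *)

Lemma exists_blocks q : #|T| = 4 * q ->
  exists f : T -> 'I_4, forall P : {set 'I_4}, #|f @^-1: P| = #|P| * q.
Proof.
move=> cardT; have eqT : #|T| = #|{: 'I_4 * 'I_q}| by rewrite card_prod !card_ord.
pose g x : 'I_4 * 'I_q := enum_val (cast_ord eqT (enum_rank x)).
have g_bij : bijective g.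
  exists (fun u => enum_val (cast_ord (esym eqT) (enum_rank u))) => u.
    by rewrite /g enum_valK cast_ordK enum_rankK.
  by rewrite /g enum_valK cast_ordKV enum_rankK.
exists (fun x => (g x).1) => P.
rewrite -[q in RHS]card_ord -cardsT -cardsX.
rewrite -(on_card_preimset (onW_bij _ g_bij)).
by apply: eq_card => x; rewrite !inE andbT.
Qed.

End Halves.

Lemma exists_regular_intersecting (T : finType) q : 1 < q -> #|T| = 2 * (2 * q) ->
    odd 'C(2 * (2 * q) - 1, 2 * q) ->
  exists F : {set {set T}}, [/\ uniform_family (2 * q) F, intersecting_family F,
    regular_family F & #|F| = 'C(2 * (2 * q) - 1, 2 * q) - 3].
Proof.
move=> q_gt1 cardT oddC; set k := 2 * q in cardT oddC *.
have k_gt1 : 1 < k by lia.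
have [f card_f] : exists f : T -> 'I_4, forall P : {set 'I_4}, #|f @^-1: P| = #|P| * q.
  by apply: exists_blocks; lia.
(* The three omitted pairs, as the six unions of two blocks. *)
pose B : {set {set T}} := [set f @^-1: P | P : {set 'I_4} in layer 'I_4 2].
have f_surj c : exists x, f x = c.
  have /card_gt0P[x] : 0 < #|f @^-1: [set c]| by rewrite card_f cards1; lia.
  by rewrite !inE => /eqP <-; exists x.
have f_inj : injective (fun P : {set 'I_4} => f @^-1: P).
  move=> P Q /setP eqPQ; apply/setP=> c; have [x <-] := f_surj c.
  by have := eqPQ x; rewrite !inE.
have cardB : #|B| = 6 by rewrite card_imset // card_draws card_ord.
have sBL : B \subset layer T k.
  by apply/subsetP=> A /imsetP[P + ->]; rewrite !inE card_f => /eqP ->.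
have setCB A : (~: A \in B) = (A \in B).
  suff impl A' : A' \in B -> ~: A' \in B by apply/idP/idP => /impl; rewrite ?setCK.
  case/imsetP=> P P2 ->; rewrite -preimsetC; apply: imset_f.
  by rewrite (@setC_layer _ 2) // card_ord.
have sepB x y : #|separating B x y| = if f x == f y then 0 else 2.
  have -> : separating B x y =
      (fun P : {set 'I_4} => f @^-1: P) @: separating (layer 'I_4 2) (f x) (f y).
    apply/setP=> A; rewrite inE; apply/andP/imsetP.
      by move=> [/imsetP[P P2 ->]]; rewrite !inE => sP; exists P; rewrite // inE P2.
    move=> [P]; rewrite inE => /andP[P2 sP] ->; split; last by rewrite !inE.
    exact: imset_f.
  rewrite card_imset //; case: eqP => [->|/eqP neq].
    by apply: eq_card0 => P; rewrite !inE andbN andbF.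
  by rewrite card_separating_layer // card_ord.
pose K := layer T k :\: B.
have sKL : K \subset layer T k by apply: subsetDl.
have compK : layer T k :\: K = B by rewrite setDDr setDv set0U (setIidPr sBL).
have /card_gt0P[o _] : 0 < #|T| by rewrite cardT; lia.
(* The star of [o] within [K] is an initial selection. *)
pose F0 := [set A in K | o \in A].
have hF0 : halves F0 K.
  have setC_K A : (~: A \in K) = (A \in K).
    by rewrite !in_setD setCB (setC_layer cardT).
  apply/forallP=> A; rewrite ![_ \in F0]in_set setC_K in_setC.
  by case: (A \in K); case: (o \in A).
have cardK : #|K| = 2 * ('C(2 * k - 1, k) - 3).
  by rewrite cardsD (setIidPr sBL) cardB card_draws cardT bin_double //; lia.
have cardF F : halves F K -> #|F| = 'C(2 * k - 1, k) - 3.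
  by move/halves_card; rewrite cardK; lia.
have [|x y|x y|F hF regF] := exists_regular_halves cardT k_gt1 hF0 sKL.
- by rewrite cardF //; lia.
- by rewrite compK sepB; case: ifP.
- have := even_separating_layer cardT x y k_gt1.
  by rewrite (card_separatingD x y sKL) compK oddD sepB; case: ifP; rewrite addbF.
exists F; split=> //; last exact: cardF.
- by rewrite -uniform_sub_layer (subset_trans (halves_sub hF)).
exact: halves_intersecting hF sKL.
Qed.

Theorem theorem25 (k : nat) (hk4 : 4 <= k) (hk2 : exists m : nat, k = 2 ^ m) :
  \max_(F : {set {set 'I_(2 * k)}} |
          [&& uniform_family k F, intersecting_family F & regular_family F]) #|F|
  = 'C(2 * k - 1, k) - 3.
Proof.
have oddC : odd 'C(2 * k - 1, k).
  (* Here [2 * k - 1] is one less than the power [2 ^ m.+1]. *)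
  case: hk2 => m km; rewrite km -expnS subn1 odd_bin_pow2_pred //.
  by rewrite ltn_exp2l.
apply/eqP; rewrite eqn_leq; apply/andP; split.
  apply/bigmax_leqP => F /and3P[unifF intF regF].
  by apply: regular_intersecting_le => //; rewrite ?card_ord //; lia.
have [q kq] : exists q, k = 2 * q.
  by case: hk2 hk4 => [[|m] ->] //; rewrite expnS; exists (2 ^ m).
subst k.
have [||F [unifF intF regF <-]] := @exists_regular_intersecting 'I_(2 * (2 * q)) q _ _ oddC.
- by lia.
- by rewrite card_ord.
by rewrite (@leq_bigmax_cond _ _ (fun F : {set {set _}} => #|F|) F) // unifF intF.
Qed.
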